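(* Let $\mathcal{X}$ be a Polish space with a complete consistent metric $d$, let $\Theta$ be a Polish space, let $\mathcal{P}\colon\Theta\to\mathcal{M}(\mathcal{X})$ be measurable with image $\mathcal{A}_0:=\mathcal{P}(\Theta)$, assume $\mathcal{P}$ is positive in the sense that $\mu(B_\delta(x))>0$ for all $\mu\in\mathcal{A}_0$, $x\in\mathcal{X}$, $\delta>0$, let $\pi_\Theta\in\mathcal{M}(\Theta)$, $\pi_0:=\mathcal{P}\pi_\Theta\in\mathcal{M}(\mathcal{A}_0)$, and let $\Phi_0\colon\mathcal{M}(\mathcal{X})\to\mathbb{R}$ be measurable and semibounded. For $\alpha>0$ let $\Pi_\alpha$ be as in the context. If \[\lim_{\delta\downarrow0}\sup_{x\in\mathcal{X}}\sup_{\theta\in\Theta}\mathcal{P}(\theta)[B_\delta(x)]=0,\] then for every $\alpha>0$ there exists $\delta_c(\alpha)>0$ such that for all $0<\delta<\delta_c(\alpha)$, all $n\in\mathbb{N}$ and all $(x_1,\dots,x_n)\in\mathcal{X}^n$, \[\mathcal{U}(\Pi_\alpha\,|\,B^n_\delta)\ge\operatorname{ess\,sup}_{\pi_0}(\Phi_0)\quad\text{and}\quad\mathcal{L}(\Pi_\alpha\,|\,B^n_\delta)\le\operatorname{ess\,inf}_{\pi_0}(\Phi_0).\]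
   Context: $\mathcal{M}(\mathcal{X})$ is the set of Borel probability measures on $\mathcal{X}$ with the weak topology, metrized by the Prokhorov metric $d_{\mathcal{M}}(\mu_1,\mu_2):=\inf\{\varepsilon>0:\mu_1(A)\le\mu_2(A^\varepsilon)+\varepsilon\ \forall A\in\mathcal{B}(\mathcal{X})\}$, where $A^\varepsilon=\{x:d(x,x')<\varepsilon\text{ for some }x'\in A\}$. $B_\delta(x)$ is the open $d$-ball of radius $\delta$ about $x$, and $B_\alpha(\mu)$ the open Prokhorov ball. $\mathcal{P}\pi_\Theta$ is the pushforward. Let $\mathcal{A}_\alpha:=\bigcup_{\mu\in\mathcal{A}_0}B_\alpha(\mu)$, $\mathcal{A}:=\{(\mu_1,\mu_2)\in\mathcal{M}(\mathcal{X})^2:\mu_1\in\mathcal{A}_0,\ d_{\mathcal{M}}(\mu_1,\mu_2)<\alpha\}$, with projections $P_0(\mu_1,\mu_2)=\mu_1$, $P_\alpha(\mu_1,\mu_2)=\mu_2$, and $\Pi_\alpha:=\{\pi_\alpha\in\mathcal{M}(\mathcal{A}_\alpha):\exists\pi\in\mathcal{M}(\mathcal{A})\text{ with }P_0\pi=\pi_0,\ P_\alpha\pi=\pi_\alpha\}$. Data: $B^n_\delta:=\prod_{i=1}^nB_\delta(x_i)$ and the data map $\mu\mapsto\mu^n$ (n-fold product). For $\pi\in\mathcal{M}(\mathcal{A}_\alpha)$ with $\mathbb{E}_{\mu\sim\pi}[\mu^n(B^n_\delta)]>0$, the posterior value is $\mathbb{E}_{\mu\sim\pi}[\Phi_0(\mu)\mu^n(B^n_\delta)]/\mathbb{E}_{\mu\sim\pi}[\mu^n(B^n_\delta)]$;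 $\mathcal{U}(\Pi_\alpha|B^n_\delta)$ (resp. $\mathcal{L}$) is the supremum (resp. infimum) of the posterior value over $\pi\in\Pi_\alpha$ with $\mathbb{E}_{\mu\sim\pi}[\mu^n(B^n_\delta)]>0$ ($\sup\varnothing=-\infty$, $\inf\varnothing=+\infty$). $\operatorname{ess\,sup}_{\pi_0}(\Phi_0):=\inf\{r\in\mathbb{R}:\pi_0[\Phi_0>r]=0\}$ and $\operatorname{ess\,inf}_{\pi_0}(\Phi_0):=\sup\{r\in\mathbb{R}:\pi_0[\Phi_0<r]=0\}$. *)

(* Defs.v *)
From HB Require Import structures.
From mathcomp Require Import all_boot all_order all_algebra.
From mathcomp Require Import all_classical all_reals all_analysis.

Set Implicit Arguments.
Unset Strict Implicit.
Unset Printing Implicit Defensive.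
Import Order.TTheory GRing.Theory Num.Theory.
Local Open Scope classical_set_scope.
Local Open Scope ring_scope.

Record metric (R : realType) (T : Type) := Metric {
  mdist :> T -> T -> R;
  mdist_ge0 : forall x y, 0 <= mdist x y;
  mdist_eq0 : forall x y, mdist x y = 0 <-> x = y;
  mdist_sym : forall x y, mdist x y = mdist y x;
  mdist_tri : forall x y z, mdist x z <= mdist x y + mdist y z }.

Section metric_notions.
Variables (R : realType) (T : Type) (dist : T -> T -> R).

Definition dball (x : T) (delta : R) : set T := [set y | dist x y < delta].

Definition dopen (U : set T) : Prop :=
  forall x, U x -> exists2 e : R, 0 < e & dball x e `<=` U.

Definition dcauchy (u : nat -> T) : Prop :=
  forall e : R, 0 < e -> exists N : nat, forall m n : nat,
    (N <= m)%N -> (N <= n)%N -> dist (u m) (u n) < e.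
Definition dconverges (u : nat -> T) (x : T) : Prop :=
  forall e : R, 0 < e -> exists N : nat, forall n : nat, (N <= n)%N -> dist (u n) x < e.
Definition dcomplete : Prop := forall u, dcauchy u -> exists x, dconverges u x.

Definition dseparable : Prop :=
  exists D : set T, countable D /\
    forall x (e : R), 0 < e -> exists2 y, D y & dist x y < e.

Definition eps_nbhd (A : set T) (e : R) : set T :=
  [set x | exists2 x', A x' & dist x x' < e].

End metric_notions.

Definition polish_metric (R : realType) (T : Type) (d : metric R T) : Prop :=
  dcomplete d /\ dseparable d.

Definition MBorel (R : realType) (T : pointedType) (dist : T -> T -> R) :=
  g_sigma_algebraType (dopen dist).

Section prokhorov.
Variables (R : realType) (X : pointedType) (d : metric R X).

Definition XB := MBorel d.
Definition MX := probability XB R.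

HB.instance Definition _ := isPointed.Build MX
  (\d_(point : XB) : probability XB R).

Definition prokhorov (mu1 mu2 : MX) : R :=
  inf [set e : R | 0 < e /\ forall A : set XB, measurable A ->
         (mu1 A <= mu2 (eps_nbhd d A e) + e%:E)%E].

Definition MXB := MBorel prokhorov.

Lemma eps_nbhd_open (A : set X) (e : R) : dopen d (eps_nbhd d A e).
Proof.
rewrite /dopen /eps_nbhd /= => x [x' Ax' dxx'].
exists (e - d x x'); first by rewrite subr_gt0.
move=> y; rewrite /dball /= => hy; exists x' => //.
apply: (le_lt_trans (mdist_tri d y x x')).
by rewrite mdist_sym -ltrBrDr.
Qed.

Lemma prokhorov_self_lt (mu : MX) (a : R) : 0 < a -> prokhorov mu mu < a.
Proof.
move=> a0; rewrite /prokhorov.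
have h2 : 0 < a / 2 by rewrite divr_gt0.
apply: (@le_lt_trans _ _ (a / 2)); last by rewrite ltr_pdivrMr // ltr_pMr // ltr1n.
apply: ge_inf.
  by exists 0 => e [] /ltW.
split => // A mA.
apply: (@le_trans _ _ (mu (eps_nbhd d A (a / 2)))).
  apply: le_measure; rewrite ?inE //.
    by apply: sub_gen_smallest; exact: eps_nbhd_open.
  move=> x Ax; exists x => //; have [_ ->] := mdist_eq0 d x x; by [].
by rewrite leeDl // lee_fin ltW.
Qed.

End prokhorov.

Section subspaces.
Variables (R : realType) (X : pointedType) (d : metric R X).
Variables (Theta : pointedType) (P : Theta -> MX d).
Variable alpha : {posnum R}.

Let dM := @prokhorov R X d.

Definition A0set : set (MX d) := range P.
Definition Aalset : set (MX d) :=
  \bigcup_(mu in A0set) dball dM mu alpha%:num.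
Definition Aset : set (MX d * MX d) :=
  [set p | A0set p.1 /\ dM p.1 p.2 < alpha%:num].

Definition A0T := {mu : MX d | A0set mu}.
Definition AalT := {mu : MX d | Aalset mu}.
Definition AT := {p : MX d * MX d | Aset p}.

HB.instance Definition _ := gen_eqMixin A0T.
HB.instance Definition _ := gen_choiceMixin A0T.
HB.instance Definition _ := gen_eqMixin AalT.
HB.instance Definition _ := gen_choiceMixin AalT.
HB.instance Definition _ := gen_eqMixin AT.
HB.instance Definition _ := gen_choiceMixin AT.

Lemma A0_point : A0set (P point). Proof. by exists point. Qed.
Lemma Aal_point : Aalset (P point).
Proof. exists (P point); first exact: A0_point. exact: prokhorov_self_lt. Qed.
Lemma A_point : Aset (P point, P point).
Proof. split; first exact: A0_point. exact: prokhorov_self_lt. Qed.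

HB.instance Definition _ := isPointed.Build A0T (exist _ _ A0_point).
HB.instance Definition _ := isPointed.Build AalT (exist _ _ Aal_point).
HB.instance Definition _ := isPointed.Build AT (exist _ _ A_point).

(* subspace metrics (restriction of d_M, resp. of the max-metric on M(X)^2,
   which induces the product topology) *)
Definition dA0 (p q : A0T) : R := dM (sval p) (sval q).
Definition dAal (p q : AalT) : R := dM (sval p) (sval q).
Definition dA (p q : AT) : R :=
  Num.max (dM (sval p).1 (sval q).1) (dM (sval p).2 (sval q).2).

Definition A0B := MBorel dA0.
Definition AalB := MBorel dAal.
Definition AB := MBorel dA.

End subspaces.

Section bounds.
Variables (R : realType) (X : pointedType) (d : metric R X).
Variables (Theta : pointedType) (P : Theta -> MX d).
Variable alpha : {posnum R}.
Variable pi0 : probability (A0B P) R.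

Local Open Scope ereal_scope.

Definition Pi_alpha : set (probability (AalB P alpha) R) :=
  [set pia | exists pi : probability (AB P alpha) R,
     (forall B : set (A0B P), measurable B ->
        pi ((fun p : AB P alpha => (sval p).1) @^-1` (sval @` B)) = pi0 B) /\
     (forall B : set (AalB P alpha), measurable B ->
        pi ((fun p : AB P alpha => (sval p).2) @^-1` (sval @` B)) = pia B)].

Local Close Scope ereal_scope.

(* mu^n(B^n_delta) = prod_i mu(B_delta(x_i)) (value of the n-fold product
   measure on the rectangle B^n_delta) *)
Definition lik (n : nat) (xs : 'I_n -> X) (delta : R) (mu : MX d) : R :=
  \prod_(i < n) fine (mu (dball d (xs i) delta)).

Local Open Scope ereal_scope.

Definition post_den (n : nat) (xs : 'I_n -> X) (delta : R)
  (pia : probability (AalB P alpha) R) : \bar R :=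
  \int[pia]_q (lik xs delta (sval q))%:E.

Definition post_num (Phi0 : MX d -> R) (n : nat) (xs : 'I_n -> X) (delta : R)
  (pia : probability (AalB P alpha) R) : \bar R :=
  \int[pia]_q (Phi0 (sval q) * lik xs delta (sval q))%:E.

Definition post_value (Phi0 : MX d -> R) (n : nat) (xs : 'I_n -> X) (delta : R)
  (pia : probability (AalB P alpha) R) : \bar R :=
  post_num Phi0 xs delta pia * ((fine (post_den xs delta pia))^-1)%:E.

Definition U_bound (Phi0 : MX d -> R) (n : nat) (xs : 'I_n -> X) (delta : R) : \bar R :=
  ereal_sup [set post_value Phi0 xs delta pia | pia in
               [set pia | Pi_alpha pia /\ 0 < post_den xs delta pia]].
Definition L_bound (Phi0 : MX d -> R) (n : nat) (xs : 'I_n -> X) (delta : R) : \bar R :=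
  ereal_inf [set post_value Phi0 xs delta pia | pia in
               [set pia | Pi_alpha pia /\ 0 < post_den xs delta pia]].

Definition ess_sup_pi0 (Phi0 : MX d -> R) : \bar R :=
  ereal_inf [set r%:E | r in [set r : R | pi0 [set q : A0B P | (Phi0 (sval q) > r)%R] = 0]].
Definition ess_inf_pi0 (Phi0 : MX d -> R) : \bar R :=
  ereal_sup [set r%:E | r in [set r : R | pi0 [set q : A0B P | (Phi0 (sval q) < r)%R] = 0]].

End bounds.

Definition semibounded (T : Type) (R : realType) (f : T -> R) : Prop :=
  (exists M : R, forall x, f x <= M) \/ (exists m : R, forall x, m <= f x).

(* Main.v *)
Require Import Defs.
From HB Require Import structures.
From mathcomp Require Import all_boot all_order all_algebra.
From mathcomp Require Import all_classical all_reals all_analysis.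
From mathcomp Require Import measurable_realfun lra.
Set Implicit Arguments.
Unset Strict Implicit.
Unset Printing Implicit Defensive.
Import Order.TTheory GRing.Theory Num.Theory.
Local Open Scope classical_set_scope.
Local Open Scope ring_scope.

(** Let [G] be a measurable set of models of positive prior mass, e.g. the set
    where [Phi0 > r] with [r] below the essential supremum.  Keep the models in
    [G], and replace every other model [mu] by [T mu], obtained from [mu] by
    moving the mass near the first data point [x] to a fixed point [y] outside
    [dball x delta].  Then [T mu] gives no mass to [dball x delta], so its
    likelihood vanishes, while its Prokhorov distance to [mu] is at most
    [mu (dball x (2 * delta))], which is less than [alpha] for small [delta].
    The resulting prior lies in [Pi_alpha] and its posterior only sees [G].

    Weighting the moved mass by a Lipschitz cutoff, instead of the indicator of
    the ball, makes [T] continuous for the Prokhorov metric; this settles its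
    measurability without countable bases. *)

(** * Open sets, continuity and Borel measurability *)

Lemma dopen_measurable (R : realType) (T : pointedType) (dist : T -> T -> R)
  (U : set T) : dopen dist U -> measurable (U : set (MBorel dist)).
Proof. by move=> ?; exact: sub_gen_smallest. Qed.

(** Preimages of open sets are open, and open sets generate. [d1] and [d2] are arbitrary functions,
    so this applies directly to [prokhorov] and to the distances [dA0], [dAal], [dA] on the
    subspaces. *)
Lemma dcontinuous_measurable (R : realType) (T1 T2 : pointedType)
    (d1 : T1 -> T1 -> R) (d2 : T2 -> T2 -> R) (f : T1 -> T2) :
  (forall x (e : R), 0 < e ->
     exists2 e', 0 < e' & forall y, d1 x y < e' -> d2 (f x) (f y) < e) ->
  measurable_fun setT (f : MBorel d1 -> MBorel d2).
Proof.
move=> cf; apply: (@measurability _ _ (MBorel d1) (MBorel d2) setT f (dopen d2)) => //.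
move=> _ [U oU <-]; rewrite setTI; apply: dopen_measurable => x Ufx.
have [e e0 eU] := oU _ Ufx; have [e' e'0 ee'] := cf x e e0.
by exists e' => // y xy; apply: eU; exact: ee'.
Qed.

(** * Prokhorov distance: ball masses and comparison of integrals *)

Section prokhorov_lemmas.
Variables (R : realType) (X : pointedType) (d : metric R X).
Implicit Types (mu nu : MX d) (A : set (XB d)) (e : R).

Lemma mdist_refl x : d x x = 0. Proof. exact/mdist_eq0. Qed.

Lemma dball_open x (r : R) : dopen d (dball d x r).
Proof.
move=> y xy; exists (r - d x y); first by rewrite subr_gt0.
move=> z; rewrite /dball/= => yz; have := mdist_tri d x y z; lra.
Qed.

Lemma measurable_dball x (r : R) : measurable (dball d x r : set (XB d)).
Proof. by apply: dopen_measurable; exact: dball_open. Qed.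

Lemma measurable_eps_nbhd (A : set X) e :
  measurable (eps_nbhd d A e : set (XB d)).
Proof. by apply: dopen_measurable; exact: eps_nbhd_open. Qed.

Lemma measurable_mdist x : measurable_fun setT (d x : XB d -> R).
Proof.
apply: (measurability _ (RGenInftyO.measurableE R)).
move=> _ [_ [r ->] <-]; rewrite setTI.
rewrite (_ : _ @^-1` _ = dball d x r); first exact: measurable_dball.
by apply/seteqP; split => z; rewrite /dball/= in_itv.
Qed.

Lemma eps_nbhd_sub (A : set X) e e' : e <= e' ->
  eps_nbhd d A e `<=` eps_nbhd d A e'.
Proof. by move=> ee' x [y Ay xy]; exists y => //; exact: lt_le_trans ee'. Qed.

Lemma sub_eps_nbhd (A : set X) e : 0 < e -> A `<=` eps_nbhd d A e.
Proof. by move=> e0 x Ax; exists x => //; rewrite mdist_refl. Qed.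

Lemma prokhorov_le mu nu e : 0 < e ->
  (forall A, measurable A -> (mu A <= nu (eps_nbhd d A e) + e%:E)%E) ->
  prokhorov mu nu <= e.
Proof. by move=> e0 h; apply: ge_inf => //; exists 0 => ? [] /ltW. Qed.

Lemma prokhorov_lt mu nu e A : prokhorov mu nu < e -> measurable A ->
  (mu A <= nu (eps_nbhd d A e) + e%:E)%E.
Proof.
move=> mne mA.
have [|e' [_ /(_ A mA) h] e'e] := inf_lt _ mne.
  (* The value 1 is always admissible, masses being at most 1, so the infimum ranges over a nonempty
     set. *)
  exists 1; split=> // B mB.
  by rewrite (le_trans (probability_le1 mu mB))// leeDr.
apply: (le_trans h); apply: leeD; last by rewrite lee_fin ltW.
apply: le_measure; rewrite ?inE; [exact: measurable_eps_nbhd..|].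
exact/eps_nbhd_sub/ltW.
Qed.

(** Lower semicontinuity of the mass of an open ball. By continuity from below, some smaller
    concentric ball still has mass above [t], and a small Prokhorov perturbation keeps that mass
    inside [dball d x r] up to a small loss. *)
Lemma dball_gt_open x (r t : R) :
  dopen (@prokhorov R X d) [set mu | (t%:E < mu (dball d x r))%E].
Proof.
move=> mu /= tmu.
have : (mu (dball d x (r - n.+1%:R^-1))) @[n --> \oo] --> mu (dball d x r).
  rewrite (_ : dball d x r = \bigcup_n dball d x (r - n.+1%:R^-1)).
    apply: (@nondecreasing_cvg_mu _ (XB d) _ mu
             (fun n => dball d x (r - n.+1%:R^-1))).
    - by move=> n; exact: measurable_dball.
    - by apply: bigcup_measurable => n _; exact: measurable_dball.
    - move=> n m nm; apply/subsetPset => y /=; rewrite /dball/=.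
      move=> /lt_le_trans; apply; rewrite lerB// lef_pV2 ?posrE ?ltr0n//.
      by rewrite ler_nat.
  apply/seteqP; split => y; rewrite /dball/=.
    move=> xy.
    have [n] := ltr_add_invr xy.
    by move=> h; exists n => //=; rewrite ltrBrDr.
  by move=> [n _] /= /lt_le_trans; apply; rewrite gerBl.
move=> /(_ [set z | (t%:E < z)%E])[|n _ /(_ n (leqnn n))].
  by apply: open_nbhs_nbhs; split=> //; exact: open_ereal_gt_ereal.
rewrite /preimage/=.
set r' := _ - _ => tr'.
have fr' : mu (dball d x r') \is a fin_num.
  by apply: fin_num_measure; exact: measurable_dball.
move: tr'; rewrite -(fineK fr') lte_fin; set m := fine _ => tm.
have r'r : r' < r by rewrite /r' gtrBl.
(* The first bound keeps the [e]-neighbourhood of the smaller ball inside [dball d x r]; the second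
   limits the lost mass to half of the excess [m - t]. *)
pose e := Num.min (r - r') ((m - t) / 2).
exists e; first by rewrite lt_min divr_gt0 ?subr_gt0 ?r'r.
move=> nu; rewrite /dball/= => mn.
have := prokhorov_lt mn (measurable_dball x r').
rewrite -(fineK fr') -/m => h.
have h2 : (nu (eps_nbhd d (dball d x r') e) <= nu (dball d x r))%E.
  apply: le_measure; rewrite ?inE; [exact: measurable_eps_nbhd|exact: measurable_dball|].
  move=> y [z]; rewrite /dball/= => xz yz.
  have : e <= r - r' by rewrite ge_min lexx.
  have := mdist_tri d x z y; rewrite (mdist_sym d z y); lra.
have fr : nu (dball d x r) \is a fin_num.
  by apply: fin_num_measure; exact: measurable_dball.
have := le_trans h (leeD2r e%:E h2).
rewrite -(fineK fr) -EFinD lee_fin lte_fin.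
have : e <= (m - t) / 2 by rewrite ge_min lexx orbT.
lra.
Qed.

Lemma measurable_dball_mass x (r : R) :
  measurable_fun setT (fun mu : MXB d => mu (dball d x r)).
Proof.
apply: (measurability _ (ErealGenOInfty.measurableE R)).
move=> _ [_ [t ->] <-]; rewrite setTI.
rewrite (_ : _ @^-1` _ = [set mu : MXB d | (t%:E < mu (dball d x r))%E]).
  by apply: dopen_measurable; exact: dball_gt_open.
by apply/seteqP; split => mu /=; rewrite in_itv/= andbT.
Qed.

(* Layer cake: [\int f dmu] is the integral of [mu [f > t]] over [0 <= t < 1], and the
   [e]-neighbourhood of [f > t] is contained in [g > t]. *)
Lemma prokhorov_integral_le mu nu e (f g : XB d -> R) :
  measurable_fun setT f -> measurable_fun setT g ->
  (forall x, 0 <= f x <= 1) -> (forall x, 0 <= g x) ->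
  (forall x y, d y x < e -> f x <= g y) ->
  0 < e -> prokhorov mu nu < e ->
  (\int[mu]_x (f x)%:E <= \int[nu]_x (g x)%:E + e%:E)%E.
Proof.
move=> mf mg f01 g0 fg e0 mn.
pose F := isMeasurableFun.Build _ _ _ _ f mf.
pose f' : {mfun XB d >-> R} := HB.pack f F.
pose G := isMeasurableFun.Build _ _ _ _ g mg.
pose g' : {mfun XB d >-> R} := HB.pack g G.
have := @ge0_expectation_ccdf _ _ _ mu f'.
have := @ge0_expectation_ccdf _ _ _ nu g'.
rewrite unlock => -> // -> //=; last first.
  by move=> x; have /andP[] := f01 x.
(* The error [e] is spread over the levels in [[0, 1]], so that the two layer-cake integrands can be
   compared level by level. *)
pose h := fun r : measurableTypeR R => (e%:E * (\1_`[0%R, 1%R] r)%:E)%E.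
have mh : measurable_fun setT h.
  by apply: emeasurable_funM => //; apply/measurable_EFinP; exact: measurable_indic.
have h0 r : (0 <= h r)%E by rewrite mule_ge0// lee_fin ltW.
have -> : e%:E = (\int[lebesgue_measure]_(r in `[0%R, +oo[) h r)%E.
  rewrite ge0_integralZl//=; last 2 first.
  - by apply/measurable_EFinP; apply: measurable_funTS; exact: measurable_indic.
  - by rewrite lee_fin ltW.
  rewrite integral_indic// setIidl.
    transitivity (e%:E * 1)%E; first by rewrite mule1.
    congr (_ * _)%E; rewrite -[LHS](_ : lebesgue_measure (`[0%R, 1%R]%classic : set R) = _)//.
    by rewrite lebesgue_measure_itv/= lte_fin ltr01 oppr0 adde0.
  by move=> r /=; rewrite !in_itv/= andbT => /andP[].
rewrite -ge0_integralD//; last 2 first.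
- by apply: measurable_funTS; exact: ccdf_measurable.
- exact: measurable_funTS.
apply: ge0_le_integral => //.
- by apply: measurable_funTS; exact: ccdf_measurable.
- apply: measurable_funTS; apply: emeasurable_funD => //; exact: ccdf_measurable.
move=> r /=; rewrite in_itv/= andbT => r0.
rewrite /h indicE.
(* Above level 1 there is no error term left, but there [f > r] is empty. *)
have [r1|r1] := leP r 1; last first.
  rewrite /ccdf/distribution/pushforward/= (_ : _ @^-1` _ = set0) ?measure0.
    by rewrite adde_ge0// mule_ge0// lee_fin ltW.
  apply/seteqP; split=> // x /=; rewrite in_itv/= andbT.
  have /andP[_] := f01 x; lra.
rewrite mem_set; last by rewrite /= in_itv/= r0.
rewrite mule1.
have mfr : measurable (f @^-1` `]r, +oo[) by rewrite -[X in measurable X]setTI; exact: (mf).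
apply: (le_trans (prokhorov_lt mn mfr)); apply: leeD => //.
apply: le_measure; rewrite ?inE; [exact: measurable_eps_nbhd| |].
  by rewrite -[X in measurable X]setTI; exact: (mg).
move=> y [x]/=; rewrite !in_itv/= !andbT => rx /fg.
exact: lt_le_trans.
Qed.
End prokhorov_lemmas.

(** * Sweeping mass away from a ball by a Lipschitz kernel *)

Section sweep.
Variables (R : realType) (X : pointedType) (d : metric R X).
Variables (x : X) (delta : R).

(** For [delta > 0], piecewise linear in the distance to [x]: 0 up to [delta], 1 from [2 * delta]
    on, with slope [delta^-1] in between. *)
Definition cutoff (z : X) : R := Num.min 1 (Num.max 0 (d x z / delta - 1)).

Lemma cutoff_ge0 z : 0 <= cutoff z.
Proof. by rewrite le_min ler01 le_max lexx. Qed.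

Lemma cutoff_le1 z : cutoff z <= 1.
Proof. by rewrite ge_min lexx. Qed.

Lemma cutoff_ball z : 0 < delta -> d x z < delta -> cutoff z = 0.
Proof.
move=> d0 xz; rewrite /cutoff max_l ?min_r ?ler01//.
by rewrite subr_le0 ler_pdivrMr// mul1r ltW.
Qed.

Lemma cutoff_far z : 0 < delta -> 2 * delta <= d x z -> cutoff z = 1.
Proof.
move=> d0 xz; rewrite /cutoff min_l// le_max; apply/orP; right.
by rewrite lerBrDr ler_pdivlMr.
Qed.

Lemma cutoff_lipschitz z w : 0 < delta -> cutoff z <= cutoff w + d w z / delta.
Proof.
move=> d0; rewrite /cutoff.
have h : d x z / delta <= d x w / delta + d w z / delta.
  by rewrite -mulrDl ler_pM2r ?invr_gt0// mdist_tri.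
have k : 0 <= d w z / delta.
  by apply: divr_ge0; [exact: Defs.mdist_ge0|exact: ltW].
rewrite addr_minl le_min !ge_min lerDl k/=; apply/orP; right.
rewrite addr_maxl ge_max !le_max add0r k/=; apply/orP; right; lra.
Qed.

Lemma measurable_cutoff : measurable_fun setT (cutoff : XB d -> R).
Proof.
apply: measurable_minr => //; apply: measurable_maxr => //.
apply: measurable_funB => //; apply: measurable_funM => //.
exact: measurable_mdist.
Qed.

Variable y : X.

(** As a function of [A], the mixture of the Dirac masses at [z] and [y] with weights [cutoff z] and
    [1 - cutoff z]. *)
Definition sweep_density (A : set (XB d)) (z : XB d) : R :=
  cutoff z * \1_A z + (1 - cutoff z) * \1_A (y : XB d).

Lemma sweep_density_ge0 A z : 0 <= sweep_density A z.
Proof.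
by rewrite addr_ge0// mulr_ge0 ?cutoff_ge0 ?subr_ge0 ?cutoff_le1.
Qed.

Lemma sweep_density_le1 A z : sweep_density A z <= 1.
Proof.
rewrite /sweep_density !indicE.
have := cutoff_ge0 z; have := cutoff_le1 z.
by case: (_ \in _); case: (_ \in _); rewrite /= ?mulr1 ?mulr0; lra.
Qed.

Lemma measurable_sweep_density A : measurable A ->
  measurable_fun setT (sweep_density A).
Proof.
move=> mA; apply: measurable_funD; apply: measurable_funM => //.
- exact: measurable_cutoff.
- by apply: measurable_funB => //; exact: measurable_cutoff.
Qed.

(* The image of [mu] under the kernel moving a point [z] to [y] with
   probability [1 - cutoff z]. *)
Definition sweep (mu : MX d) (A : set (XB d)) : \bar R :=
  (\int[mu]_z (sweep_density A z)%:E)%E.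

Section sweep_probability.
Variable mu : MX d.

Let sweep0 : sweep mu set0 = 0%E.
Proof.
rewrite /sweep integral0_eq// => z _.
by rewrite /sweep_density !indicE !in_set0 !mulr0 addr0.
Qed.

Let sweep_ge0 A : (0 <= sweep mu A)%E.
Proof. by apply: integral_ge0 => z _; rewrite lee_fin sweep_density_ge0. Qed.

Let sweep_sigma_additive : semi_sigma_additive (sweep mu).
Proof.
move=> F mF tF mUF.
have -> : sweep mu (\bigcup_n F n) = (\sum_(0 <= i <oo) sweep mu (F i))%E.
  rewrite /sweep -integral_nneseries//; last 2 first.
  - by move=> n; apply/measurable_EFinP; exact: measurable_sweep_density.
  - by move=> n z _; rewrite lee_fin sweep_density_ge0.
  apply: eq_integral => z _.
  have c1 : 0 <= 1 - cutoff z by rewrite subr_ge0 cutoff_le1.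
  (* For fixed [z] the density is a measure in [A]; its additivity is integrated term by term, all
     terms being nonnegative. *)
  pose K : {measure set (XB d) -> \bar R} :=
    measure_add (mscale (NngNum (cutoff_ge0 z)) (\d_(z : XB d)))
    (mscale (NngNum c1) (\d_(y : XB d))).
  have KE A : K A = (sweep_density A z)%:E.
    transitivity (measure_add (mscale (NngNum (cutoff_ge0 z)) (\d_(z : XB d)))
      (mscale (NngNum c1) (\d_(y : XB d))) A) => //.
    by rewrite measure_addE/= /mscale/= !diracE -!EFinM -EFinD /sweep_density !indicE.
  rewrite -KE measure_semi_bigcup//=.
  by apply: eq_eseriesr => i _; rewrite KE.
by apply: is_cvg_ereal_nneg_natsum_cond => n _ _; exact: sweep_ge0.
Qed.

HB.instance Definition _ := isMeasure.Build _ _ _ (sweep mu)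
  sweep0 sweep_ge0 sweep_sigma_additive.

Let sweep_setT : sweep mu setT = 1%E.
Proof.
rewrite /sweep (eq_integral (cst 1%E)).
  by rewrite integral_cst// mul1e; exact: probability_setT.
move=> z _; rewrite /sweep_density !indicT/= !mulr1; congr EFin; lra.
Qed.

HB.instance Definition _ := Measure_isProbability.Build _ _ _ (sweep mu) sweep_setT.

End sweep_probability.

(** A point of the ball always jumps, and every jump lands on [y], outside the ball. *)
Lemma sweep_ball (mu : MX d) : 0 < delta -> ~ dball d x delta y ->
  sweep mu (dball d x delta) = 0%E.
Proof.
move=> d0 nxy; rewrite /sweep integral0_eq// => z _; congr EFin.
rewrite /sweep_density !indicE (memNset nxy) mulr0 addr0.
have [/set_mem xz|_] := boolP (z \in _); last by rewrite mulr0.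
by rewrite cutoff_ball// mul0r.
Qed.

(** Only points of the ball of radius [2 * delta] can move, so [A] loses at most the mass of that
    ball. This mass serves as the admissible [e], which must be positive. *)
Lemma prokhorov_sweep_le (mu : MX d) : 0 < delta ->
  (0 < mu (dball d x (2 * delta)))%E ->
  prokhorov mu (sweep mu) <= fine (mu (dball d x (2 * delta))).
Proof.
move=> d0 mu0.
have fB : mu (dball d x (2 * delta)) \is a fin_num.
  by apply: fin_num_measure; exact: measurable_dball.
have e0 : 0 < fine (mu (dball d x (2 * delta))) by rewrite fine_gt0// mu0 ltey_eq fB.
apply: prokhorov_le => // A mA; rewrite fineK//.
apply: (@le_trans _ _ (sweep mu A + mu (dball d x (2 * delta)))%E); last first.
  apply: leeD => //; apply: le_measure; rewrite ?inE//.
    exact: measurable_eps_nbhd.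
  exact: sub_eps_nbhd.
rewrite -[dball d x (2 * delta)]setIT -integral_indic//; last exact: measurable_dball.
rewrite -{1}[A]setIT -integral_indic//.
rewrite /sweep -ge0_integralD//; last 3 first.
- by move=> z _; rewrite lee_fin sweep_density_ge0.
- by apply/measurable_EFinP; exact: measurable_sweep_density.
- by apply/measurable_EFinP; apply: measurable_indic; exact: measurable_dball.
apply: ge0_le_integral => //.
- by apply/measurable_EFinP; exact: measurable_indic.
- apply/measurable_EFinP; apply: measurable_funD.
    exact: measurable_sweep_density.
  by apply: measurable_indic; exact: measurable_dball.
move=> z _; rewrite -EFinD lee_fin.
have := sweep_density_ge0 A z; rewrite /sweep_density !indicE => h.
have [_|] := boolP (z \in dball d x (2 * delta)).
  by rewrite (le_trans (y := 1))// ?lerDr// lern1 leq_b1.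
rewrite notin_setE /dball/= => /negP; rewrite -leNgt => /(cutoff_far d0) ->.
by rewrite subrr mul0r mul1r !addr0.
Qed.

(** In the constant, 1 is the cost of passing from [mu] to [nu], and [delta^-1] is the Lipschitz
    constant of the cutoff. *)
Lemma prokhorov_sweep_lipschitz (mu nu : MX d) (e : R) : 0 < delta -> 0 < e ->
  prokhorov mu nu < e ->
  prokhorov (sweep mu) (sweep nu) <= (delta^-1 + 1) * e.
Proof.
move=> d0 e0 mn.
have di0 : 0 < delta^-1 by rewrite invr_gt0.
have ee' : e <= (delta^-1 + 1) * e by apply: ler_peMl; [exact: ltW|lra].
apply: prokhorov_le => [|A mA]; first exact: lt_le_trans ee'.
have mAe := @measurable_eps_nbhd _ _ d A e.
have mS := measurable_sweep_density mAe.
(* The term [e / delta] absorbs the change of the cutoff between two points at distance less than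
   [e]. *)
pose g z := sweep_density (eps_nbhd d A e) z + e / delta.
have h : (sweep mu A <= \int[nu]_z (g z)%:E + e%:E)%E.
  apply: prokhorov_integral_le => //.
  - exact: measurable_sweep_density.
  - exact: measurable_funD.
  - by move=> z; rewrite sweep_density_ge0 sweep_density_le1.
  - by move=> z; rewrite addr_ge0 ?sweep_density_ge0// divr_ge0// ltW.
  move=> z w wz; rewrite /g /sweep_density !indicE.
  have de : d w z / delta <= e / delta by rewrite ler_pM2r// ltW.
  have := cutoff_lipschitz z w d0; have := cutoff_lipschitz w z d0.
  rewrite (mdist_sym d z w).
  have := cutoff_ge0 z; have := cutoff_ge0 w; have := cutoff_le1 z; have := cutoff_le1 w.
  (* If [z] is in [A] then [w] is in its [e]-neighbourhood, and likewise [y] stays in it; each case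
     is then linear in the two cutoff values. *)
  have [/set_mem zA|zA] := boolP (z \in A).
    rewrite (_ : (w \in eps_nbhd d A e) = true); last by apply: mem_set; exists z.
    have [/set_mem yA|yA] := boolP ((y : XB d) \in A).
      rewrite (_ : (y \in eps_nbhd d A e) = true); last by apply: mem_set; exact: sub_eps_nbhd.
      by rewrite /= !mulr1; lra.
    by case: (_ \in _); rewrite /= !mulr1 !mulr0; lra.
  have [/set_mem yA|yA] := boolP ((y : XB d) \in A).
    rewrite (_ : (y \in eps_nbhd d A e) = true); last by apply: mem_set; exact: sub_eps_nbhd.
    by case: (_ \in _); rewrite /= !mulr1 !mulr0; lra.
  by case: (_ \in _); case: (_ \in _); rewrite /= ?mulr1 ?mulr0; lra.
apply: (le_trans h).
have -> : (\int[nu]_z (g z)%:E = sweep nu (eps_nbhd d A e) + (e / delta)%:E)%E.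
  rewrite /g; under eq_integral do rewrite EFinD.
  rewrite ge0_integralD//.
  - by rewrite integral_cst// [X in (_ * X)%E]probability_setT mule1.
  - by move=> z _; rewrite lee_fin sweep_density_ge0.
  - exact/measurable_EFinP.
  - by move=> z _; rewrite lee_fin divr_ge0// ltW.
rewrite -addeA; apply: leeD.
  apply: le_measure; rewrite ?inE//; [exact: measurable_eps_nbhd|].
  exact: eps_nbhd_sub.
by rewrite -EFinD lee_fin mulrDl mul1r mulrC.
Qed.

End sweep.

(** * Change of variables and monotonicity for signed integrands *)

Lemma measurable_fun_mem (d1 : measure_display) (T : measurableType d1)
    (G : set T) : measurable G -> measurable_fun setT (fun x => x \in G).
Proof.
move=> mG; apply: (measurable_fun_bool true).
rewrite setTI (_ : _ @^-1` _ = G)//.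
by apply/seteqP; split=> x /=; [exact: set_mem|exact: mem_set].
Qed.

(** Positive and negative parts are transported separately. This covers the numerator of the
    posterior value, whose integral may be infinite. *)
Lemma integral_distribution_measurable (d1 d2 : measure_display)
    (T1 : measurableType d1) (T2 : measurableType d2) (R : realType)
    (p : probability T1 R) (F : {mfun T1 >-> T2}) (f : T2 -> \bar R) :
  measurable_fun setT f ->
  (\int[distribution p F]_y f y = \int[p]_x f (F x))%E.
Proof.
move=> mf; rewrite integralE [RHS]integralE; congr (_ - _)%E.
- rewrite ge0_integral_distribution//; last exact: measurable_funepos.
  by rewrite -funepos_comp.
- rewrite ge0_integral_distribution//; last exact: measurable_funeneg.
  by rewrite -funeneg_comp.
Qed.

(** The positive part grows with the function and the negative part shrinks; the subtraction takes
    place in the extended reals, so infinite values are allowed. *)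
Lemma le_integral_measurable (d1 : measure_display) (T : measurableType d1)
    (R : realType) (mu : {measure set T -> \bar R}) (f g : T -> \bar R) :
  measurable_fun setT f -> measurable_fun setT g -> (forall x, f x <= g x)%E ->
  (\int[mu]_x f x <= \int[mu]_x g x)%E.
Proof.
move=> mf mg fg; rewrite integralE [X in (_ <= X)%E]integralE; apply: leeB.
- apply: ge0_le_integral => //.
  + exact: measurable_funepos.
  + exact: measurable_funepos.
  + by move=> x _; apply: (@funepos_le _ _ setT) => [z _|]; rewrite ?inE //; exact: fg.
- apply: ge0_le_integral => //.
  + exact: measurable_funeneg.
  + exact: measurable_funeneg.
  + by move=> x _; apply: (@funeneg_le _ _ setT) => [z _|]; rewrite ?inE //; exact: fg.
Qed.

(** * Perturbed priors in [Pi_alpha] *)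

Section perturbation.
Variables (R : realType) (X : pointedType) (d : metric R X).
Variables (Theta : pointedType) (P : Theta -> MX d) (alpha : {posnum R}).
Variable pi0 : probability (A0B P) R.

Section pairing.
Variable T : MX d -> MX d.
Hypothesis T_cont : forall (mu : MX d) (e : R), 0 < e ->
  exists2 e', 0 < e' &
    forall nu, prokhorov mu nu < e' -> prokhorov (T mu) (T nu) < e.
Hypothesis T_near : forall theta, prokhorov (P theta) (T (P theta)) < alpha%:num.

Lemma pairing_subproof (q : A0T P) : Aset P alpha (sval q, T (sval q)).
Proof.
case: q => mu /= [theta _ <-]; split; last exact: T_near.
by exists theta.
Qed.

Definition pairing (q : A0B P) : AB P alpha := exist _ _ (pairing_subproof q).

Lemma measurable_pairing : measurable_fun setT pairing.
Proof.
apply: dcontinuous_measurable => q e e0.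
have [e' e'0 ee'] := T_cont (sval q) e0.
exists (Num.min e e'); first by rewrite lt_min e0.
move=> q'; rewrite lt_min => /andP[qe qe'].
by rewrite /dA/= gt_max qe ee'.
Qed.

End pairing.

Lemma Aset_snd (p : AT P alpha) : Aalset P alpha (sval p).2.
Proof. by case: p => -[mu nu] /= [A0mu munu]; exists mu. Qed.

Definition AB_snd (p : AB P alpha) : AalB P alpha := exist _ _ (Aset_snd p).

Lemma measurable_AB_snd : measurable_fun setT AB_snd.
Proof.
apply: dcontinuous_measurable => p e e0; exists e => // p'.
by rewrite /dA gt_max => /andP[].
Qed.

Lemma measurable_AalB_val : measurable_fun setT (sval : AalB P alpha -> MXB d).
Proof. by apply: dcontinuous_measurable => p e e0; exists e. Qed.

Lemma measurable_A0B_val : measurable_fun setT (sval : A0B P -> MXB d).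
Proof. by apply: dcontinuous_measurable => p e e0; exists e. Qed.

(** [Pi_alpha] states its marginals through images under [sval]; this turns them into pushforwards
    by maps into the subtype. *)
Lemma preimage_sval (T1 U : Type) (Q : U -> Prop) (f : T1 -> U)
    (hf : forall x, Q (f x)) (B : set {u | Q u}) :
  f @^-1` (sval @` B) = (fun x => exist Q (f x) (hf x)) @^-1` B.
Proof.
apply/seteqP; split=> x /=.
  by move=> [[u Qu] Bu /= uf]; rewrite (_ : exist _ _ _ = exist _ u Qu)//; exact: eq_exist.
by move=> Bx; exists (exist _ (f x) (hf x)).
Qed.

(** The coupling is the image of [pi0] under [q |-> (q, q)] on [G] and [q |-> (q, T q)] off [G]. The
    first coordinate is untouched, so the first marginal is [pi0]; the second marginal is [pia], and
    two changes of variables give the formula. *)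
Lemma Pi_alpha_perturbation (T : MX d -> MX d) (G : set (A0B P)) :
  measurable G ->
  (forall (mu : MX d) (e : R), 0 < e -> exists2 e', 0 < e' &
    forall nu, prokhorov mu nu < e' -> prokhorov (T mu) (T nu) < e) ->
  (forall theta, prokhorov (P theta) (T (P theta)) < alpha%:num) ->
  exists2 pia : probability (AalB P alpha) R, Pi_alpha pi0 pia &
    forall f : MXB d -> \bar R, measurable_fun setT f ->
    (\int[pia]_q f (sval q) =
     \int[pi0]_q f (if q \in G then sval q else T (sval q)))%E.
Proof.
move=> mG T_cont T_near.
have id_near theta : prokhorov (P theta) (id (P theta)) < alpha%:num.
  exact: prokhorov_self_lt.
pose F (q : A0B P) : AB P alpha :=
  if q \in G then pairing (T := id) id_near q else pairing (T := T) T_near q.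
have mF : measurable_fun setT F.
  apply: measurable_fun_if => //.
  - exact: measurable_fun_mem.
  - apply: measurable_funTS; apply: measurable_pairing => mu e e0.
    by exists e.
  - by apply: measurable_funTS; exact: measurable_pairing.
pose F' : {mfun A0B P >-> AB P alpha} := HB.pack F (isMeasurableFun.Build _ _ _ _ F mF).
pose S' : {mfun AB P alpha >-> AalB P alpha} :=
  HB.pack AB_snd (isMeasurableFun.Build _ _ _ _ AB_snd measurable_AB_snd).
pose pi : probability (AB P alpha) R := distribution pi0 F'.
exists (distribution pi S' : probability (AalB P alpha) R).
  exists pi; split=> B mB.
    rewrite /pi /distribution /pushforward/=; congr (pi0 _).
    apply/seteqP; split=> q /=.
      move=> [[mu A0mu] Bmu /= mE].
      rewrite (_ : q = exist _ mu A0mu)//.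
      by case: q mE => nu A0nu; rewrite /F; case: ifP => _ /= E; exact: eq_exist.
    by move=> Bq; exists q => //; rewrite /F; case: ifP.
  by rewrite (preimage_sval Aset_snd).
move=> f mf.
have mfv : measurable_fun setT (fun q : AalB P alpha => f (sval q)).
  exact: (measurableT_comp mf measurable_AalB_val).
apply: (etrans (integral_distribution_measurable pi S' mfv)).
have mfs : measurable_fun setT (fun p => f (sval (AB_snd p))).
  exact: (measurableT_comp mfv measurable_AB_snd).
apply: (etrans (integral_distribution_measurable pi0 F' mfs)).
by apply: eq_integral => q _ /=; rewrite /F; case: ifP.
Qed.

End perturbation.

(** * Comparison by real thresholds, and positivity of integrals *)

Lemma lee_from_below (R : realType) (a b : \bar R) :
  (forall r : R, r%:E < a -> r%:E <= b)%E -> (a <= b)%E.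
Proof.
move=> h; rewrite leNgt; apply/negP.
case: a b h => [a| |] [b| |] h //.
- rewrite lte_fin => ba; have := h ((a + b) / 2).
  by rewrite lte_fin lee_fin => /(_ ltac:(lra)); clear h; lra.
- by have := h (a - 1); rewrite lte_fin leeNy_eq => /(_ ltac:(lra)).
- by move=> _; have := h (b + 1) (ltry _); rewrite lee_fin; clear h; lra.
- by have := h 0 (ltry _); rewrite leeNy_eq.
Qed.

Lemma lee_from_above (R : realType) (a b : \bar R) :
  (forall r : R, a < r%:E -> b <= r%:E)%E -> (b <= a)%E.
Proof.
move=> h; rewrite -leeN2; apply: lee_from_below => r.
by rewrite lteNr -EFinN => /h; rewrite EFinN leeNr.
Qed.

(** A nonnegative function with zero integral vanishes almost everywhere, which would make [G]
    null. *)
Lemma integral_gt0 (d1 : measure_display) (T : measurableType d1)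
    (R : realType) (mu : {measure set T -> \bar R}) (f : T -> \bar R)
    (G : set T) :
  measurable_fun setT f -> (forall x, 0 <= f x)%E -> measurable G ->
  (forall x, G x -> 0 < f x)%E -> mu G <> 0%E -> (0 < \int[mu]_x f x)%E.
Proof.
move=> mf f0 mG fG muG; rewrite lt0e integral_ge0// andbT; apply/eqP => i0.
apply: muG; apply/(negligibleP mu mG).
have /(ae_eq_integral_abs mu measurableT mf) : (\int[mu]_x `|f x| = 0)%E.
  by rewrite -[RHS]i0; apply: eq_integral => x _; rewrite gee0_abs.
apply: negligibleS => x Gx /=; rewrite not_implyE; split=> //.
by move=> fx; have := fG x Gx; rewrite fx ltxx.
Qed.

(** * Bounds and measurability of the likelihood *)

Section likelihood.
Variables (R : realType) (X : pointedType) (d : metric R X).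
Variables (n : nat) (xs : 'I_n -> X) (delta : R).

Lemma dball_mass_ge0 (mu : MX d) x : 0 <= fine (mu (dball d x delta)).
Proof. exact: fine_ge0. Qed.

Lemma lik_ge0 (mu : MX d) : 0 <= lik xs delta mu.
Proof. by apply: prodr_ge0 => i _; exact: dball_mass_ge0. Qed.

Lemma lik_le1 (mu : MX d) : lik xs delta mu <= 1.
Proof.
apply: prodr_ile1 => i _; rewrite dball_mass_ge0/=.
have mB := @measurable_dball _ _ d (xs i) delta.
by rewrite -lee_fin fineK ?fin_num_measure// probability_le1.
Qed.

Lemma lik_gt0 (mu : MX d) : (forall x, 0 < mu (dball d x delta))%E ->
  0 < lik xs delta mu.
Proof.
move=> mu0; apply: prodr_gt0 => i _; rewrite fine_gt0// mu0/=.
by rewrite ltey_eq fin_num_measure//; exact: measurable_dball.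
Qed.

Lemma lik_eq0 (mu : MX d) i : mu (dball d (xs i) delta) = 0%E ->
  lik xs delta mu = 0.
Proof. by move=> mu0; rewrite /lik (bigD1 i)//= mu0 mul0r. Qed.

Lemma measurable_lik : measurable_fun setT (lik xs delta : MXB d -> R).
Proof.
apply: measurable_prod => i _.
apply: measurableT_comp; first exact: fine_measurable.
exact: measurable_dball_mass.
Qed.

End likelihood.

(** * Concentration of the posterior on a set of positive prior mass *)

Section concentration.
Variables (R : realType) (X : pointedType) (d : metric R X).
Variables (Theta : pointedType) (P : Theta -> MX d) (alpha : {posnum R}).
Variable pi0 : probability (A0B P) R.
Hypothesis P_pos : forall theta x (delta : R), 0 < delta ->
  (0 < P theta (dball d x delta))%E.
Variable Phi0 : MX d -> R.
Hypothesis mPhi0 : measurable_fun setT (Phi0 : MXB d -> R).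

(** The posterior value becomes the average of [Phi0] over [G] with weight [lik], so any lower or
    upper bound of [Phi0] on [G] passes to it. *)
Lemma posterior_concentration (n : nat) (xs : 'I_n -> X) (i : 'I_n)
    (delta : R) (G : set (A0B P)) :
  0 < delta ->
  (forall theta, P theta (dball d (xs i) (2 * delta)) < alpha%:num%:E)%E ->
  (forall theta, P theta (dball d (xs i) (2 * delta)) < 1)%E ->
  measurable G -> pi0 G <> 0%E ->
  exists pia : probability (AalB P alpha) R, [/\ Pi_alpha pi0 pia,
    (0 < post_den xs delta pia)%E,
    (forall r : R, (forall q, G q -> r <= Phi0 (sval q)) ->
       (r%:E <= post_value Phi0 xs delta pia)%E) &
    (forall r : R, (forall q, G q -> Phi0 (sval q) <= r) ->
       (post_value Phi0 xs delta pia <= r%:E)%E)].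
Proof.
move=> delta0 Palpha P1 mG pi0G.
(* Otherwise the ball of radius [2 * delta] would be the whole space and have mass 1. *)
have [y nxy] : exists y, ~ dball d (xs i) delta y.
  apply/existsNP => xE; have := P1 point.
  rewrite (_ : dball _ _ _ = setT) ?probability_setT ?ltxx//.
  apply/seteqP; split=> // z _; have := xE z; rewrite /dball/=; lra.
pose T (mu : MX d) : MX d := sweep (xs i) delta y mu.
have likT mu : lik xs delta (T mu) = 0.
  by apply: (@lik_eq0 _ _ _ _ _ _ _ i); exact: sweep_ball.
have [||pia Ppia piaE] := @Pi_alpha_perturbation _ _ _ _ P alpha pi0 T G mG.
(* The Lipschitz bound is not strict, so the modulus aims at [e / 2]. *)
- move=> mu e e0; exists (e / 2 / (delta^-1 + 1)).
    by rewrite !divr_gt0// addr_gt0// invr_gt0.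
  have c0 : 0 < delta^-1 + 1 by rewrite addr_gt0// invr_gt0.
  move=> nu mn; apply: (@le_lt_trans _ _ (e / 2)); last lra.
  apply: (le_trans (prokhorov_sweep_lipschitz _ _ delta0 _ mn)).
    by rewrite !divr_gt0.
  by rewrite mulrC divfK// gt_eqF.
- move=> theta; apply: (le_lt_trans (@prokhorov_sweep_le _ _ d (xs i) delta y (P theta) delta0 _)).
    by apply: P_pos; rewrite mulr_gt0.
  rewrite -lte_fin fineK// fin_num_measure//; exact: measurable_dball.
exists pia.
(* [h] and [k] are the integrands of denominator and numerator pulled back to [pi0]; both vanish off
   [G] because [likT] kills the swept models. *)
pose h (q : A0B P) : R := if q \in G then lik xs delta (sval q) else 0.
pose k (q : A0B P) : R := if q \in G then Phi0 (sval q) * lik xs delta (sval q) else 0.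
have mGb := measurable_fun_mem mG.
have mlik : measurable_fun setT (fun q : A0B P => lik xs delta (sval q)).
  exact: (measurableT_comp (@measurable_lik _ _ d n xs delta) (@measurable_A0B_val _ _ d _ P)).
have mh : measurable_fun setT h by exact: measurable_fun_ifT.
have mk : measurable_fun setT k.
  apply: measurable_fun_ifT => //; apply: measurable_funM => //.
  exact: (measurableT_comp mPhi0 (@measurable_A0B_val _ _ d _ P)).
have h0 q : 0 <= h q by rewrite /h; case: ifP => // _; exact: lik_ge0.
have h1 q : h q <= 1 by rewrite /h; case: ifP => // _; exact: lik_le1.
have denE : post_den xs delta pia = (\int[pi0]_q (h q)%:E)%E.
  rewrite /post_den (piaE (fun mu => (lik xs delta mu)%:E)).
    by apply: eq_integral => q _; rewrite /h; case: ifP => // _; rewrite likT.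
  by apply/measurable_EFinP; exact: measurable_lik.
have numE : post_num Phi0 xs delta pia = (\int[pi0]_q (k q)%:E)%E.
  rewrite /post_num (piaE (fun mu => (Phi0 mu * lik xs delta mu)%:E)).
    by apply: eq_integral => q _; rewrite /k; case: ifP => // _; rewrite likT mulr0.
  by apply/measurable_EFinP; apply: measurable_funM => //; exact: measurable_lik.
(* Integrability of [h] makes the denominator finite, so that [fine] in [post_value] does not fall
   back to its default. *)
have ih : pi0.-integrable setT (EFin \o h).
  apply: measurable_bounded_integrable => //.
    by rewrite [X in (X < _)%E]probability_setT ltry.
  exists 1; split=> // M M1 q _ /=; rewrite ger0_norm//.
  by rewrite (le_trans (h1 q))// ltW.
have den0 : (0 < post_den xs delta pia)%E.
  rewrite denE; apply: (integral_gt0 _ _ mG) => //.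
  - exact/measurable_EFinP.
  - move=> q Gq; rewrite lte_fin /h mem_set//; apply: lik_gt0 => x.
    by have [theta _ <-] := svalP q; exact: P_pos.
have denf : post_den xs delta pia \is a fin_num.
  by rewrite denE; exact: integrable_fin_num.
have fden0 : 0 < fine (post_den xs delta pia).
  by rewrite fine_gt0// den0 ltey_eq denf.
split=> // r Gr; rewrite /post_value.
(* Clearing the denominator leaves the pointwise comparison of [r * h] with [k]. *)
- rewrite lee_pdivlMr// fineK// numE denE -integralZl//.
  apply: le_integral_measurable.
  + by apply/measurable_EFinP; exact: measurable_funM.
  + exact/measurable_EFinP.
  + move=> q; rewrite lee_fin /h /k; case: ifPn => [/set_mem Gq|_].
      by rewrite ler_wpM2r ?lik_ge0// Gr.
    by rewrite mulr0.
- rewrite lee_pdivrMr// fineK// numE denE -integralZl//.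
  apply: le_integral_measurable.
  + exact/measurable_EFinP.
  + by apply/measurable_EFinP; exact: measurable_funM.
  + move=> q; rewrite lee_fin /h /k; case: ifPn => [/set_mem Gq|_].
      by rewrite ler_wpM2r ?lik_ge0// Gr.
    by rewrite mulr0.
Qed.

End concentration.

(** * Bounds by the essential supremum and infimum *)

Unset Implicit Arguments.

Theorem theorem6p4 (R : realType)
  (X : pointedType) (d : metric R X) (hX : polish_metric d)
  (Theta : pointedType) (dT : metric R Theta) (hT : polish_metric dT)
  (P : Theta -> MX d)
  (hPmeas : measurable_fun setT (P : MBorel dT -> MXB d))
  (hPpos : forall (theta : Theta) (x : X) (delta : R), 0 < delta ->
             (0 < P theta (dball d x delta))%E)
  (piT : probability (MBorel dT) R)
  (pi0 : probability (A0B P) R)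
  (hpi0 : forall B : set (A0B P), measurable B ->
            pi0 B = piT (P @^-1` (sval @` B)))
  (Phi0 : MX d -> R)
  (hPhimeas : measurable_fun setT (Phi0 : MXB d -> R))
  (hPhisb : semibounded Phi0)
  (hlim : (fun delta : R =>
             ereal_sup (range (fun p : Theta * X => P p.1 (dball d p.2 delta))))
            @ 0^'+ --> 0%E) :
  forall alpha : {posnum R}, exists2 deltac : R, 0 < deltac &
    forall delta : R, 0 < delta -> delta < deltac ->
    forall (n : nat) (xs : 'I_n -> X), (0 < n)%N ->
      (ess_sup_pi0 pi0 Phi0 <= U_bound alpha pi0 Phi0 xs delta)%E /\
      (L_bound alpha pi0 Phi0 xs delta <= ess_inf_pi0 pi0 Phi0)%E.
Proof.
move=> alpha.
(* Ball masses below [alpha] keep the swept models close enough; masses below 1 leave room for the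
   point [y]. *)
have a10 : 0 < Num.min alpha%:num 1 by rewrite lt_min gt0 ltr01.
have /hlim [e /= e0 he] : nbhs (0 : \bar R) [set z | (z < (Num.min alpha%:num 1)%:E)%E].
  apply: open_nbhs_nbhs; split; first exact: open_ereal_lt_ereal.
  by rewrite /= lte_fin.
(* The masses to control are those of balls of radius [2 * delta], hence the factor 2. *)
exists (e / 2); first by rewrite divr_gt0.
move=> delta delta0 deltae n xs n0.
pose i := Ordinal n0.
have Pmin theta : (P theta (dball d (xs i) (2 * delta)) < (Num.min alpha%:num 1)%:E)%E.
  apply: le_lt_trans (he (2 * delta) _ _); last 2 first.
  - by rewrite /ball/= sub0r normrN gtr0_norm; lra.
  - by rewrite mulr_gt0.
  by apply: ereal_sup_ubound; exists (theta, xs i).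
have Palpha theta : (P theta (dball d (xs i) (2 * delta)) < alpha%:num%:E)%E.
  by apply: (lt_le_trans (Pmin theta)); rewrite lee_fin ge_min lexx.
have P1 theta : (P theta (dball d (xs i) (2 * delta)) < 1)%E.
  by apply: (lt_le_trans (Pmin theta)); rewrite lee_fin ge_min lexx orbT.
have mPhi : measurable_fun setT (fun q : A0B P => Phi0 (sval q)).
  exact: (measurableT_comp hPhimeas (@measurable_A0B_val _ _ d _ P)).
split.
- apply: lee_from_below => r rlt.
  have mG : measurable [set q : A0B P | r < Phi0 (sval q)].
    by have := mPhi measurableT _ (measurable_itv `]r, +oo[); rewrite setTI set_itvoy.
  have pi0G : pi0 [set q : A0B P | r < Phi0 (sval q)] <> 0%E.
    (* If this set were null, [r] would compete in the infimum and bound the essential supremum from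
       above. *)
    move=> G0; move: rlt; rewrite ltNge => /negP; apply.
    by apply: ereal_inf_lbound; exists r.
  have [pia [Ppia den0 ge_r _]] :=
    posterior_concentration hPpos hPhimeas delta0 Palpha P1 mG pi0G.
  apply: (le_trans (ge_r r (fun q => @ltW _ _ _ _))).
  by apply: ereal_sup_ubound; exists pia.
- apply: lee_from_above => r rlt.
  have mG : measurable [set q : A0B P | Phi0 (sval q) < r].
    by have := mPhi measurableT _ (measurable_itv `]-oo, r[); rewrite setTI set_itvNyo.
  have pi0G : pi0 [set q : A0B P | Phi0 (sval q) < r] <> 0%E.
    move=> G0; move: rlt; rewrite ltNge => /negP; apply.
    by apply: ereal_sup_ubound; exists r.
  have [pia [Ppia den0 _ le_r]] :=
    posterior_concentration hPpos hPhimeas delta0 Palpha P1 mG pi0G.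
  apply: (le_trans _ (le_r r (fun q => @ltW _ _ _ _))).
  by apply: ereal_inf_lbound; exists pia.
Qed.
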